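(* Let $n\ge1$, $1\le k\le n$. The set $M=\{(w,u(w))\}$ of pairs defined below is a partial matching on the Hasse diagram of $\Pi(n,k)$ which is acyclic: there is no sequence of distinct elements $a_1,\dots,a_r$, $r\ge2$, with $a_1\lessdot u(a_1)\gtrdot a_2\lessdot u(a_2)\gtrdot\cdots\gtrdot a_r\lessdot u(a_r)\gtrdot a_1$.
   Context: $\mathcal R(n,k)$ is the set of RG-words $w=w_1\cdots w_n$ (positive integers, $w_1=1$, $w_i\le\max(w_1,\dots,w_{i-1})+1$, $\max_iw_i=k$). $\Pi(n,k)$ is the poset on $\mathcal R(n,k)$ generated by covers $v\lessdot w$ when $w$ arises from $v$ by increasing exactly one entry by $1$. The matching: for $w\in\mathcal R(n,k)$ let $i\ge2$ be the smallest index such that $w_1\le w_2\le\dots\le w_{i-1}$ and either $w_{i-1}>w_i$, or $w_{i-1}=w_i$ with both even. If $w_i$ is odd, $w$ is matched with $u(w)=w_1\cdots w_{i-1}(w_i+1)w_{i+1}\cdots w_n$ (a cover of $w$); if $w_i$ is even, $w$ is matched with $d(w)=w_1\cdots w_{i-1}(w_i-1)w_{i+1}\cdots w_n$ (covered by $w$), i.e. $u(d(w))=w$. If no such $i$ exists, $w$ is unmatched. *)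

(* Defs.v *)
From mathcomp Require Import all_boot.

Set Implicit Arguments.
Unset Strict Implicit.
Unset Printing Implicit Defensive.

(* A word w_1 ... w_n is a [seq nat]; positions are 0-based, so that w_i is
   [nth 0 w i.-1]. *)

Definition rg_word (n k : nat) (w : seq nat) : bool :=
  [&& size w == n,
      all (fun x => 0 < x) w,
      nth 0 w 0 == 1,
      [forall i : 'I_n, nth 0 w i <= (\max_(x <- take i w) x).+1]
    & \max_(x <- w) x == k].

Definition incr_at (w : seq nat) (i : nat) : seq nat :=
  set_nth 0 w i (nth 0 w i).+1.

Definition decr_at (w : seq nat) (i : nat) : seq nat :=
  set_nth 0 w i (nth 0 w i).-1.

Definition rg_step (n k : nat) (v w : seq nat) : Prop :=
  [/\ rg_word n k v, rg_word n k w
    & exists2 i, i < n & w = incr_at v i].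

Inductive rg_le (n k : nat) (v : seq nat) : seq nat -> Prop :=
| rg_le_refl : rg_word n k v -> rg_le n k v v
| rg_le_step w w' : rg_le n k v w -> rg_step n k w w' -> rg_le n k v w'.

Definition rg_lt (n k : nat) (v w : seq nat) : Prop :=
  rg_le n k v w /\ v <> w.

Definition rg_cover (n k : nat) (v w : seq nat) : Prop :=
  rg_lt n k v w /\ ~ (exists z, rg_lt n k v z /\ rg_lt n k z w).

Definition candidate (w : seq nat) (i : nat) : bool :=
  [&& 0 < i, i < size w, sorted leq (take i w)
    & (nth 0 w i < nth 0 w i.-1)
      || [&& nth 0 w i.-1 == nth 0 w i, ~~ odd (nth 0 w i.-1)
           & ~~ odd (nth 0 w i)]].

(* The smallest candidate, or [size w] if there is none. *)
Definition pivot (w : seq nat) : nat := find (candidate w) (iota 0 (size w)).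

Definition matched_up (w : seq nat) : bool :=
  (pivot w < size w) && odd (nth 0 w (pivot w)).

Definition matched_down (w : seq nat) : bool :=
  (pivot w < size w) && ~~ odd (nth 0 w (pivot w)).

(* Only meaningful on words satisfying [matched_up], resp. [matched_down]. *)
Definition up (w : seq nat) : seq nat := incr_at w (pivot w).
Definition down (w : seq nat) : seq nat := decr_at w (pivot w).

Definition rg_matching (n k : nat) (v w : seq nat) : Prop :=
  [/\ rg_word n k v, matched_up v & w = up v].

Definition partial_matching (T : Type) (cover M : T -> T -> Prop) : Prop :=
  (forall a b, M a b -> cover a b) /\
  (forall x a b c d, M a b -> M c d ->
     x = a \/ x = b -> x = c \/ x = d -> (a, b) = (c, d)).

(* The generating steps are exactly the covers: the sum of the letters is a
   rank function. *)

Lemma sumn_incr_at (w : seq nat) (i : nat) :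
  i < size w -> sumn (incr_at w i) = (sumn w).+1.
Proof. by move=> lt_iw; rewrite /incr_at sumn_set_nth_ltn // addnS subSn ?addnK ?leq_addl. Qed.

Lemma rg_word_size n k w : rg_word n k w -> size w = n.
Proof. by case/and5P=> /eqP. Qed.

Lemma rg_step_sumn n k v w : rg_step n k v w -> sumn w = (sumn v).+1.
Proof.
by case=> /rg_word_size sv _ [i lt_in ->]; rewrite sumn_incr_at ?sv.
Qed.

Lemma rg_le_sumn n k v w : rg_le n k v w -> v = w \/ sumn v < sumn w.
Proof.
elim=> [_|w1 w2 _ IH /rg_step_sumn ->]; first by left.
by right; case: IH => [->|/ltnW]; rewrite ltnS.
Qed.

Lemma rg_lt_sumn n k v w : rg_lt n k v w -> sumn v < sumn w.
Proof. by case=> /rg_le_sumn[]. Qed.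

Lemma rg_le_trans n k v w z : rg_le n k v w -> rg_le n k w z -> rg_le n k v z.
Proof. by move=> vw; elim=> // z1 z2 _ IH; apply: rg_le_step. Qed.

Lemma rg_le_anti n k v w : rg_le n k v w -> rg_le n k w v -> v = w.
Proof.
move=> /rg_le_sumn[] // lt_vw /rg_le_sumn[] // lt_wv.
by have := ltn_trans lt_vw lt_wv; rewrite ltnn.
Qed.

Lemma rg_step_lt n k v w : rg_step n k v w -> rg_lt n k v w.
Proof.
move=> st; have [rv _ _] := st.
split; first exact: rg_le_step (rg_le_refl rv) st.
by move=> e; have := rg_step_sumn st; rewrite e => /n_Sn.
Qed.

Lemma rg_coverP n k v w : rg_cover n k v w <-> rg_step n k v w.
Proof.
split=> [[[le_vw neq_vw] no_z]|st].
  case: le_vw neq_vw no_z => [//|w1 w2 le1 st neq no_z].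
  have [evw1|/eqP neq1] := eqVneq v w1; first by rewrite evw1.
  by case: no_z; exists w1; split; [split|apply: rg_step_lt].
split=> [|[z [/rg_lt_sumn lt1 /rg_lt_sumn]]]; first exact: rg_step_lt.
by rewrite (rg_step_sumn st) ltnS leqNgt lt1.
Qed.

(* The two matching rules agree: when the pivot letter of [w] is even, [down w]
   is matched up and [up (down w) = w]. *)

Lemma candidate_pivot w : pivot w < size w -> candidate w (pivot w).
Proof.
move=> lt_p; have := lt_p; rewrite -{1}(size_iota 0 (size w)) -has_find.
by move/(nth_find 0); rewrite nth_iota.
Qed.

Lemma before_pivot w j : j < pivot w -> candidate w j = false.
Proof.
move=> lt_j; have := before_find 0 lt_j; rewrite nth_iota //.
apply: leq_trans lt_j _.
by have := find_size (candidate w) (iota 0 (size w)); rewrite size_iota.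
Qed.

Lemma pivot_eq w p :
  candidate w p -> (forall j, j < p -> candidate w j = false) -> pivot w = p.
Proof.
move=> cp np; case: (ltngtP (pivot w) p) => // lt_p.
  have lt_pw : p < size w by case/and4P: cp.
  by have := candidate_pivot (ltn_trans lt_p lt_pw); rewrite np.
by move/before_pivot: lt_p; rewrite cp.
Qed.

Lemma leq_bigmax_take (v w : seq nat) i : size v = size w ->
  (forall j, j < i -> j < size w ->
     exists j', [/\ j' < i, j' < size w & nth 0 v j <= nth 0 w j']) ->
  \max_(x <- take i v) x <= \max_(x <- take i w) x.
Proof.
move=> esz le_vw; apply/bigmax_leqP_seq => x /(nthP 0)[j].
rewrite size_take_min esz leq_min => /andP[lt_ji lt_j] <- _.
have [j' [lt_j'i lt_j' le_j]] := le_vw j lt_ji lt_j.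
rewrite nth_take //; apply: leq_trans le_j _.
rewrite -(nth_take 0 lt_j'i); apply: (leq_bigmax_seq (F := id)) => //.
by rewrite mem_nth // size_take_min leq_min lt_j'i.
Qed.

Lemma rg_matching_down n k w :
  rg_word n k w -> matched_down w -> rg_matching n k (down w) w.
Proof.
move=> rw /andP[lt_p even_p]; have cp := candidate_pivot lt_p.
have := @before_pivot w.
rewrite /down; move: (pivot w) => p in lt_p even_p cp * => np.
set v := decr_at w p.
have /and5P[/eqP sw pos_w w0 grow_w max_w] := rw.
case/and4P: cp => p_gt0 _ sorted_p le_p.
have wp_gt0 : 0 < nth 0 w p by apply: (allP pos_w); rewrite mem_nth.
have sv : size v = size w by rewrite size_set_nth (maxn_idPr lt_p).
have nthv j : nth 0 v j = if j == p then (nth 0 w p).-1 else nth 0 w j.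
  by rewrite nth_set_nth /=.
have takev j : j <= p -> take j v = take j w.
  move=> le_jp; apply: (@eq_from_nth _ 0); rewrite !size_take_min sv // => i.
  rewrite leq_min => /andP[lt_ij _]; rewrite !nth_take // nthv ltn_eqF //.
  exact: leq_trans lt_ij le_jp.
have neq_p1 : (p.-1 == p) = false by rewrite ltn_eqF // ltn_predL.
have lt_p1 : p.-1 < size w by apply: leq_ltn_trans (leq_pred p) lt_p.
have le_wp : nth 0 w p <= nth 0 w p.-1.
  by case/orP: le_p => [/ltnW|/and3P[/eqP->]].
have maxv i : \max_(x <- take i v) x = \max_(x <- take i w) x.
  apply/eqP; rewrite eqn_leq; apply/andP; split; apply: leq_bigmax_take => //.
    move=> j lt_ji lt_j; exists j; split=> //; rewrite nthv.
    by case: eqP => // ->; apply: leq_pred.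
  rewrite sv => j lt_ji lt_j; case: (eqVneq j p) => [ejp|neq_jp].
    exists p.-1; split=> //; last by rewrite nthv neq_p1 ejp.
    by rewrite (leq_ltn_trans _ lt_ji) // ejp leq_pred.
  by exists j; rewrite nthv (negPf neq_jp).
have wp_gt1 : 1 < nth 0 w p.
  by rewrite ltn_neqAle wp_gt0 andbT; apply: contraNneq even_p => <-.
have odd_p : odd (nth 0 w p).-1.
  by move: even_p wp_gt0; case: (nth 0 w p) => //= m; rewrite negbK.
have pv : pivot v = p.
  apply: pivot_eq => [|j lt_jp].
    rewrite /candidate sv p_gt0 lt_p takev // sorted_p !nthv eqxx neq_p1.
    by rewrite (leq_trans _ le_wp) // ltn_predL.
  rewrite -(np j lt_jp) /candidate sv takev ?(ltnW lt_jp) // !nthv.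
  by rewrite (ltn_eqF lt_jp) (ltn_eqF (leq_ltn_trans (leq_pred j) lt_jp)).
split.
- apply/and5P; split.
  + by rewrite sv sw.
  + apply/allP => x /(nthP 0)[j]; rewrite sv nthv => lt_j <-.
    case: eqP => _; first by rewrite -ltnS prednK.
    by apply: (allP pos_w); rewrite mem_nth.
  + by rewrite nthv (ltn_eqF p_gt0).
  + apply/forallP => i; rewrite maxv nthv; case: eqP => [eip|_].
      by rewrite (leq_trans (leq_pred _)) // -eip; apply: (forallP grow_w).
    exact: (forallP grow_w).
  + by have := maxv (size w); rewrite take_size -{1}sv take_size => ->.
- by rewrite /matched_up pv sv lt_p nthv eqxx.
rewrite /up pv /incr_at nthv eqxx prednK //.
apply: (@eq_from_nth _ 0) => [|j lt_j].
  by rewrite size_set_nth sv (maxn_idPr lt_p).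
by rewrite nth_set_nth /= nthv; case: eqP => // ->.
Qed.

(* Main.v *)
(** The pivot strictly increases along any alternating path
    [a < up a > c < up c] with [c <> a], so such a path cannot close up.
    Indeed [c] differs from [b := up a] by lowering one letter other than the
    pivot letter of [b].  If the pivot [p'] of [c] were at most the pivot [p] of
    [b], the odd letter [c_p'] would be a descent of [c].  At [p' = p] this
    contradicts the evenness of [b_p].  At [p' < p], where [b] weakly increases,
    the descent must come from lowering [b_p' = b_(p'-1)]; that repeated letter
    is even, so [p'] would already be a candidate for [b]. *)
Require Import Defs.
From mathcomp Require Import all_boot.

Set Implicit Arguments.
Unset Strict Implicit.
Unset Printing Implicit Defensive.

(** Out-of-range positions agree too, since [set_nth] pads with the same 0 that [nth] returns by
    default. *)
Lemma nth_incr_at (w : seq nat) i j :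
  nth 0 (incr_at w i) j = nth 0 w j + (j == i).
Proof.
by rewrite nth_set_nth /=; case: eqP => [->|_]; rewrite ?addn1 ?addn0.
Qed.

Lemma size_incr_at (w : seq nat) i : i < size w -> size (incr_at w i) = size w.
Proof. by move=> lt_i; rewrite size_set_nth (maxn_idPr lt_i). Qed.

Lemma take_incr_at (w : seq nat) i j :
  i < size w -> j <= i -> take j (incr_at w i) = take j w.
Proof.
move=> lt_i le_ji; apply: (@eq_from_nth _ 0) => [|l].
  by rewrite !size_take_min size_incr_at.
rewrite size_take_min leq_min => /andP[lt_lj _].
by rewrite !nth_take // nth_incr_at ltn_eqF ?addn0 // (leq_trans lt_lj).
Qed.

Lemma incr_atK (w : seq nat) i :
  i < size w -> decr_at (incr_at w i) i = w.
Proof.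
move=> lt_i; apply: (@eq_from_nth _ 0) => [|j _].
  by rewrite size_set_nth size_incr_at // (maxn_idPr lt_i).
by rewrite nth_set_nth /= !nth_incr_at eqxx addn1; case: eqP => [->|]; rewrite ?addn0.
Qed.

(** An odd pivot letter rules out the equal-and-even alternative of [candidate]. *)
Lemma matched_up_descent w : matched_up w ->
  [/\ 0 < pivot w, odd (nth 0 w (pivot w))
    & nth 0 w (pivot w) < nth 0 w (pivot w).-1].
Proof.
case/andP=> lt_p odd_p; have /and4P[p_gt0 _ _] := candidate_pivot lt_p.
by rewrite odd_p !andbF orbF.
Qed.

(** Raising the odd letter below its left neighbour leaves either a descent or two equal even
    letters, so the position stays a candidate. Whether an earlier position is one depends only on
    letters before the pivot. *)
Lemma pivot_up w : matched_up w -> pivot (up w) = pivot w.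
Proof.
move=> mw; have [p_gt0 odd_p lt_wp] := matched_up_descent mw.
case/andP: mw => lt_p _; have /and4P[_ _ sorted_p _] := candidate_pivot lt_p.
apply: pivot_eq => [|j lt_jp].
  rewrite /candidate p_gt0 size_incr_at // lt_p take_incr_at // sorted_p.
  rewrite !nth_incr_at eqxx (ltn_eqF (_ : _.-1 < _)) ?ltn_predL // addn1 addn0 /=.
  by move: lt_wp; rewrite leq_eqVlt => /predU1P[<-|-> //]; rewrite eqxx /= odd_p orbT.
rewrite -(before_pivot lt_jp) /candidate size_incr_at // take_incr_at ?(ltnW lt_jp) //.
rewrite !nth_incr_at (ltn_eqF lt_jp).
by rewrite (ltn_eqF (leq_ltn_trans (leq_pred j) lt_jp)) !addn0.
Qed.

Lemma matched_down_up w : matched_up w -> matched_down (up w).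
Proof.
move=> mw; have [_ odd_p _] := matched_up_descent mw.
have lt_p : pivot w < size w by case/andP: mw.
by rewrite /matched_down pivot_up // size_incr_at // lt_p nth_incr_at eqxx addn1 /= odd_p.
Qed.

Lemma upK w : matched_up w -> down (up w) = w.
Proof.
by move=> mw; rewrite /down pivot_up // incr_atK //; case/andP: mw.
Qed.

(** The raised letter does not exceed its left neighbour, so every prefix maximum is preserved. *)
Lemma rg_word_up n k w : rg_word n k w -> matched_up w -> rg_word n k (up w).
Proof.
move=> /and5P[/eqP sw pos_w w0 grow_w max_w] mw.
have [p_gt0 _ lt_wp] := matched_up_descent mw.
have {mw} lt_p : pivot w < size w by case/andP: mw.
rewrite /up; move: (pivot w) => p in p_gt0 lt_wp lt_p *.
have sv := size_incr_at lt_p.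
have lt_p1 : p.-1 < p by rewrite ltn_predL.
have maxv i : \max_(x <- take i (incr_at w p)) x = \max_(x <- take i w) x.
  apply/eqP; rewrite eqn_leq; apply/andP; split; apply: leq_bigmax_take => //.
    move=> j lt_ji lt_j; case: (eqVneq j p) => [ejp|neq_jp].
      exists p.-1; rewrite nth_incr_at ejp eqxx addn1; split=> //.
        by rewrite (leq_trans lt_p1) // -ejp ltnW.
      exact: ltn_trans lt_p1 lt_p.
    by exists j; rewrite nth_incr_at (negPf neq_jp) addn0.
  by move=> j lt_ji lt_j; exists j; rewrite nth_incr_at leq_addr.
apply/and5P; split.
- by rewrite sv sw.
- apply/allP => x /(nthP 0)[j]; rewrite sv nth_incr_at => lt_j <-.
  by rewrite (leq_trans _ (leq_addr _ _)) //; apply: (allP pos_w); rewrite mem_nth.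
- by rewrite nth_incr_at (ltn_eqF p_gt0) addn0.
- apply/forallP => i; rewrite maxv nth_incr_at.
  case: eqP => [->|_]; last by rewrite addn0; apply: (forallP grow_w).
  rewrite addn1 ltnS (leq_trans (ltnW lt_wp)) // -(nth_take 0 lt_p1).
  apply: (leq_bigmax_seq (F := id)) => //.
  by rewrite mem_nth // size_take_min leq_min lt_p1 (ltn_trans lt_p1).
- by have := maxv (size w); rewrite take_size -{1}sv take_size => ->.
Qed.

Lemma rg_matching_step n k v w : rg_matching n k v w -> rg_step n k v w.
Proof.
case=> rv mv ->; split=> //; first exact: rg_word_up.
by exists (pivot v) => //; rewrite -(rg_word_size rv); case/andP: mv.
Qed.

(** The parity of the pivot letter separates lower ends from upper ends, and [down] recovers the
    lower end of a pair from its upper end. *)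
Lemma partial_rg_matching n k : partial_matching (rg_cover n k) (rg_matching n k).
Proof.
split=> [a b /rg_matching_step/rg_coverP //|x a b c d [_ ma ->] [_ mc ->]].
have up_not_matched_up u v : matched_up u -> matched_up v -> u <> up v.
  by move=> /andP[_ oddu] /matched_down_up/andP[_ evenv] e; rewrite -e oddu in evenv.
case=> -> [] e.
- by rewrite e.
- by case: (up_not_matched_up _ _ ma mc).
- by case: (up_not_matched_up _ _ mc ma).
- by rewrite -(upK ma) e upK.
Qed.

(** The prefix before [j] is sorted, being part of the one before the pivot, so [j] can only fail
    the last clause of [candidate]. *)
Lemma before_pivot_leq w j : pivot w < size w -> 0 < j -> j < pivot w ->
  nth 0 w j.-1 <= nth 0 w j /\ (nth 0 w j.-1 = nth 0 w j -> odd (nth 0 w j)).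
Proof.
move=> lt_p j_gt0 lt_jp; have /and4P[_ _ sorted_p _] := candidate_pivot lt_p.
have sorted_j : sorted leq (take j w).
  by rewrite -(take_takel _ (ltnW lt_jp)); apply: take_sorted.
have := before_pivot lt_jp.
rewrite /candidate j_gt0 (ltn_trans lt_jp lt_p) sorted_j /=.
case: ltngtP => //= [lt_j _|->]; last by rewrite andbb => /negbFE.
by split=> // e_j; rewrite e_j ltnn in lt_j.
Qed.

Lemma pivot_ltn b c i : matched_down b -> matched_up c -> down b <> c ->
  i < size c -> b = incr_at c i -> pivot b < pivot c.
Proof.
case/andP=> lt_p even_p mc neq lt_i eb.
have [c_gt0 odd_c lt_c] := matched_up_descent mc.
(* Otherwise lowering the pivot letter of [b] would give back [c]. *)
have neq_pi : pivot b != i.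
  by apply/eqP => ep; apply: neq; rewrite /down ep eb incr_atK.
have nthb j : nth 0 b j = nth 0 c j + (j == i) by rewrite eb nth_incr_at.
rewrite ltnNge leq_eqVlt; apply/negP => /orP[/eqP ep|lt_cp].
  by rewrite nthb (negPf neq_pi) addn0 -ep odd_c in even_p.
have [le_b odd_b] := before_pivot_leq lt_p c_gt0 lt_cp.
have le_cb1 : nth 0 c (pivot c).-1 <= nth 0 b (pivot c).-1 by rewrite nthb leq_addr.
have lt_cb := leq_trans lt_c le_cb1.
(* With [q] the pivot of [c], this is [c_q < b_q], which forces [q = i]. *)
have := leq_trans lt_cb le_b.
rewrite nthb; case: eqP => [epi _|_]; last by rewrite addn0 ltnn.
have eb_c : nth 0 b (pivot c) = (nth 0 c (pivot c)).+1 by rewrite nthb epi eqxx addn1.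
(* Squeezed: [c_q < b_(q-1) <= b_q = c_q + 1]. *)
have /odd_b : nth 0 b (pivot c).-1 = nth 0 b (pivot c).
  by apply/eqP; rewrite eqn_leq le_b eb_c.
by rewrite eb_c /= odd_c.
Qed.

(** An index maximising [f] would be beaten by its cyclic successor. *)
Lemma no_cyclic_increase r (f : 'I_r -> nat) :
  0 < r -> ~ (forall j, f j < f (ordS j)).
Proof.
case: r f => // r f _ incr_f.
have [j _ max_j] := arg_maxnP f (erefl : xpredT (@ord0 r)).
by have := max_j (ordS j) isT; rewrite /= leqNgt incr_f.
Qed.

Lemma ordS_neq r (j : 'I_r) : 1 < r -> ordS j != j.
Proof.
move=> r_gt1; rewrite -val_eqE /=; have := ltn_ord j.
rewrite leq_eqVlt => /predU1P[ejr|lt_j]; last by rewrite modn_small // gtn_eqF.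
(* The last index wraps around to 0; being fixed there would mean [r = 1]. *)
by rewrite ejr modnn; apply: contraTneq r_gt1 => j0; rewrite -ejr -j0.
Qed.

Theorem theorem4p3 (n k : nat) (n_ge1 : 1 <= n) (k_bounds : 1 <= k <= n) :
  partial_matching (rg_cover n k) (rg_matching n k) /\
  ~ (exists (r : nat) (a : 'I_r -> seq nat),
      [/\ 2 <= r,
          injective a,
          forall j, rg_matching n k (a j) (up (a j))
        & forall j, rg_cover n k (a j) (up (a j)) /\
                    rg_cover n k (a (ordS j)) (up (a j))]).
Proof.
split; first exact: partial_rg_matching.
case=> r [a [r_gt1 inj_a match_a cover_a]].
apply: (@no_cyclic_increase r (fun j => pivot (a j)) (ltnW r_gt1)) => j.
have [_ mj _] := match_a j; have [_ mSj _] := match_a (ordS j).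
have [_ /rg_coverP[rSj _ [i lt_i eq_up]]] := cover_a j.
rewrite -(pivot_up mj); apply: (pivot_ltn _ mSj _ _ eq_up).
- exact: matched_down_up.
(* Distinctness of the [a j] guarantees that the path does not descend along the matched edge it
   came up. *)
- by rewrite upK // => /inj_a/esym/eqP; rewrite (negPf (ordS_neq j r_gt1)).
- by rewrite (rg_word_size rSj).
Qed.
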